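(* Let $\Omega\subset\mathbb{H}^n$ be a nonempty open convex set, let $\mathcal{P}$ be the set of all supporting hyperplanes of $\Omega$, and let $F$ be the Funk metric of $\Omega$. Then for all distinct points $x,y\in\Omega$ such that the geodesic ray $R(x,y)$ from $x$ through $y$ is not contained in $\Omega$, $$F(x,y)=\sup_{\pi\in\mathcal{P}}\log\frac{\sinh d(x,\pi)}{\sinh d(y,\pi)}.$$
   Context: $\mathbb{H}^n$ is $n$-dimensional hyperbolic space of constant curvature $-1$ and $d$ is its hyperbolic distance; $d(x,\pi)$ is the distance from the point $x$ to the set $\pi$. A supporting hyperplane of $\Omega$ is a totally geodesic hypersurface $\pi\subset\mathbb{H}^n$ that contains a boundary point of $\Omega$ and such that $\Omega$ is contained in one of the two open half-spaces bounded by $\pi$. For distinct $x,y\in\Omega$, $R(x,y)=\{\exp_x(t\xi_{xy}) : t>0\}$ is the hyperbolic geodesic ray starting at $x$ and passing through $y$, where $\xi_{xy}$ is the unit tangent vector at $x$ pointing toward $y$; if $R(x,y)$ meets $\partial\Omega$ (boundary in $\mathbb{H}^n$), $b(x,y)$ denotes the intersection point. The Funk metric of $\Omega$ is $$F(x,y)=\log\frac{\sinh d(x,b(x,y))}{\sinh d(y,b(x,y))}$$ if $x\neq y$ and $R(x,y)\cap\partial\Omega\neq\emptyset$, and $F(x,y)=0$ otherwise. *)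

(* Defs.v *)
From mathcomp Require Import all_boot all_order all_algebra.
From mathcomp Require Import all_classical all_reals all_analysis.

Set Implicit Arguments.
Unset Strict Implicit.
Unset Printing Implicit Defensive.

Import Order.TTheory GRing.Theory Num.Theory.
Import numFieldNormedType.Exports.

Local Open Scope classical_set_scope.
Local Open Scope ring_scope.

(** Hyperbolic space of curvature -1 is represented by the hyperboloid model:
    the upper sheet of [<u, u> = -1] in Minkowski space R^{n,1}, coordinate 0
    being the timelike one.  A [set] coerces to its [set_type], so
    [x : hyp R n] is a point of H^n, and [hyp R n] carries the topology
    induced from ['rV[R]_n.+1], which is also that of the distance [hdist]. *)

Section Hyperbolic.
Variable R : realType.

Definition cosh (t : R) : R := (expR t + expR (- t)) / 2.
Definition sinh (t : R) : R := (expR t - expR (- t)) / 2.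

(* the inverse of [cosh] on [0, +oo[; meaningful for [1 <= t] *)
Definition arcosh (t : R) : R := ln (t + Num.sqrt (t ^+ 2 - 1)).

Variable n : nat.

Definition lorentz (u v : 'rV[R]_n.+1) : R :=
  - (u ord0 ord0 * v ord0 ord0)
  + \sum_(i < n) u ord0 (lift ord0 i) * v ord0 (lift ord0 i).

Definition hyp : set 'rV[R]_n.+1 :=
  [set u | lorentz u u = -1 /\ 0 < u ord0 ord0].

Implicit Types (x y : hyp) (A Omega : set hyp).

(* [cosh (d (x, y)) = - <x, y>] *)
Definition hdist x y : R := arcosh (- lorentz (\val x) (\val y)).

Definition hdist_set x A : R := inf [set hdist x p | p in A].

(* [exp_x (t xi)] for a unit vector [xi] tangent to the hyperboloid at [x] *)
Definition hexp x (xi : 'rV[R]_n.+1) (t : R) : 'rV[R]_n.+1 :=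
  cosh t *: \val x + sinh t *: xi.

(* The unit tangent vector at [x] pointing toward [y] (for [x <> y]), obtained
   by solving [y = hexp x xi (hdist x y)] for [xi]. *)
Definition hdir x y : 'rV[R]_n.+1 :=
  (sinh (hdist x y))^-1 *: (\val y - cosh (hdist x y) *: \val x).

Definition hray x y : set hyp :=
  [set z | exists2 t : R, 0 < t & \val z = hexp x (hdir x y) t].

Definition hsegment x y : set hyp :=
  [set z | exists2 t : R, 0 <= t <= hdist x y & \val z = hexp x (hdir x y) t].

Definition hconvex Omega : Prop :=
  forall x y, Omega x -> Omega y -> x <> y -> hsegment x y `<=` Omega.

(* The complete totally geodesic hypersurfaces of H^n are its sections by the
   linear hyperplanes [nu^perp] with [nu] spacelike; the two open half-spaces
   bounded by [hplane nu] are [hhalfspace nu] and [hhalfspace (- nu)]. *)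
Definition hplane (nu : 'rV[R]_n.+1) : set hyp :=
  [set z : hyp | lorentz nu (\val z) = 0].

Definition hhalfspace (nu : 'rV[R]_n.+1) : set hyp :=
  [set z : hyp | 0 < lorentz nu (\val z)].

Definition bdry Omega : set hyp := closure Omega `\` interior Omega.

Definition supporting_hyperplanes Omega : set (set hyp) :=
  [set pi | exists nu : 'rV[R]_n.+1,
    [/\ lorentz nu nu = 1, pi = hplane nu, pi `&` bdry Omega !=set0 &
        Omega `<=` hhalfspace nu \/ Omega `<=` hhalfspace (- nu)]].

(* The intersection point [b(x, y)]; the default value [x] is irrelevant. *)
Definition exit_point Omega x y : hyp := xget x (hray x y `&` bdry Omega).

Definition funk Omega x y : R :=
  if `[< x <> y /\ hray x y `&` bdry Omega !=set0 >] then
    ln (sinh (hdist x (exit_point Omega x y)) /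
        sinh (hdist y (exit_point Omega x y)))
  else 0.

End Hyperbolic.

Arguments hyp : clear implicits.

(* Main.v *)
Require Import Defs.
From mathcomp Require Import all_boot all_order all_algebra.
From mathcomp Require Import all_classical all_reals all_analysis.
From mathcomp Require Import ring lra.

Set Implicit Arguments.
Unset Strict Implicit.
Unset Printing Implicit Defensive.

Import Order.TTheory GRing.Theory Num.Theory.
Import numFieldNormedType.Exports.

Local Open Scope classical_set_scope.
Local Open Scope ring_scope.

(** In the hyperboloid model both sides become linear algebra in Minkowski
    space.  For a unit spacelike [nu], the distance from [x] to the hyperplane
    [nu^perp] satisfies [sinh d(x, nu^perp) = |<nu, x>|] ([sinh_hdist_plane]),
    so the quotient attached to a hyperplane is a quotient of values of a
    linear form.  Along the unit speed geodesic [g] from [g 0 = x] through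
    [g d = y], any three points satisfy the linear relation
    [sinh (t - r) g(s) = sinh (t - s) g(r) + sinh (s - r) g(t)]
    ([geod_interp]).  Let [b = g t] be a point of the ray on the boundary, and
    let [nu^perp] be a supporting hyperplane with [Omega] on its positive side.
    Then [<nu, b>] is nonnegative by continuity, and the relation at the
    parameters 0, d, t gives
    [sinh t <nu, y> >= sinh (t - d) <nu, x>],
    which says that the quotient of [nu] is at most
    [sinh t / sinh (t - d) = sinh d(x, b) / sinh d(y, b)].  Equality holds when
    [nu^perp] passes through [b]; in that case the relation also forces
    [d < t].  Since this applies to every boundary point [b] of the ray, the
    uniqueness of the exit point never has to be discussed.

    It remains to find a supporting hyperplane through [b] ([support_through]).
    The positive multiples of points of [Omega] form a convex cone, open
    because [Omega] is, which contains neither [b] nor [- b].  A finite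
    dimensional Hahn-Banach argument ([cone_separation]) gives a linear form
    positive on the cone and zero at [b]; a vector orthogonal to the timelike
    [b] is spacelike ([timelike_orthogonal]), so this form is, after
    normalization, a hyperplane of the hyperbolic space. *)

(** * Hyperbolic functions *)

Section HyperbolicFunctions.
Variable R : realType.
Implicit Types a b c s t : R.

Lemma cosh_sinh_sqr t : cosh t ^+ 2 = 1 + sinh t ^+ 2.
Proof.
have e : expR t * expR (- t) = 1 by rewrite -expRD subrr expR0.
by rewrite -e /cosh /sinh; field.
Qed.

Lemma cosh0 : cosh (0 : R) = 1.
Proof. by rewrite /cosh oppr0 expR0; lra. Qed.

Lemma sinh0 : sinh (0 : R) = 0.
Proof. by rewrite /sinh oppr0 expR0; lra. Qed.

Lemma coshB s t : cosh (s - t) = cosh s * cosh t - sinh s * sinh t.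
Proof. by rewrite /cosh /sinh opprB !expRD; field. Qed.

Lemma sinhB s t : sinh (s - t) = sinh s * cosh t - cosh s * sinh t.
Proof. by rewrite /cosh /sinh opprB !expRD; field. Qed.

Lemma sinh_ge0 t : (0 <= sinh t) = (0 <= t).
Proof.
rewrite /sinh pmulr_lge0 ?invr_gt0// subr_ge0 ler_expR.
by apply/idP/idP; lra.
Qed.

Lemma sinh_gt0 t : (0 < sinh t) = (0 < t).
Proof.
rewrite /sinh pmulr_lgt0 ?invr_gt0// subr_gt0 ltr_expR.
by apply/idP/idP; lra.
Qed.

Lemma cosh_gt0 t : 0 < cosh t.
Proof. by rewrite /cosh divr_gt0// addr_gt0// expR_gt0. Qed.

Lemma cosh_arcosh c : 1 <= c -> cosh (arcosh c) = c.
Proof.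
move=> c1; have c2 : 0 <= c ^+ 2 - 1 by nra.
have s0 := sqrtr_ge0 (c ^+ 2 - 1); have := sqr_sqrtr c2.
rewrite /cosh /arcosh; move: (Num.sqrt _) s0 => s s0 s2.
have w0 : 0 < c + s by lra.
rewrite expRN lnK ?posrE//; apply: (mulfI (lt0r_neq0 w0)).
rewrite mulrA mulrDr mulfV ?lt0r_neq0//.
by nra.
Qed.

Lemma arcosh_ge0 c : 1 <= c -> 0 <= arcosh c.
Proof.
by move=> c1; apply: ln_ge0; have := sqrtr_ge0 (c ^+ 2 - 1); lra.
Qed.

Lemma sinh_arcosh c : 1 <= c -> sinh (arcosh c) = Num.sqrt (c ^+ 2 - 1).
Proof.
move=> c1; rewrite -{2}(cosh_arcosh c1) cosh_sinh_sqr addrAC subrr add0r.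
by rewrite sqrtr_sqr ger0_norm// sinh_ge0 arcosh_ge0.
Qed.

Lemma coshK t : 0 <= t -> arcosh (cosh t) = t.
Proof.
move=> t0; rewrite /arcosh cosh_sinh_sqr addrAC subrr add0r sqrtr_sqr.
rewrite ger0_norm ?sinh_ge0// (_ : _ + _ = expR t) ?expRK//.
by rewrite /cosh /sinh; lra.
Qed.

Lemma arcosh_le a b : 1 <= a -> a <= b -> arcosh a <= arcosh b.
Proof.
move=> a1 ab; have b1 : 1 <= b by lra.
rewrite /arcosh ler_ln ?posrE; last 2 first.
- by rewrite ltr_wpDr ?sqrtr_ge0//; lra.
- by rewrite ltr_wpDr ?sqrtr_ge0//; lra.
by rewrite lerD// ler_wsqrtr// lerD2r; nra.
Qed.

Lemma cosh_continuous : continuous (@cosh R).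
Proof.
move=> t; apply: cvgM; last exact: cvg_cst; apply: cvgD; first exact: continuous_expR.
by apply: (@continuous_comp _ _ _ -%R expR); [exact: opp_continuous|exact: continuous_expR].
Qed.

Lemma sinh_continuous : continuous (@sinh R).
Proof.
move=> t; apply: cvgM; last exact: cvg_cst; apply: cvgB; first exact: continuous_expR.
by apply: (@continuous_comp _ _ _ -%R expR); [exact: opp_continuous|exact: continuous_expR].
Qed.

End HyperbolicFunctions.

(** * Separation of a convex cone from a line *)

Section Separation.
Variables (R : realType) (V : lmodType R).
Implicit Types (C D : set V) (b c e v w x : V).

(** The convex cones for which the separation argument runs.  Openness is only
    asked for in the form in which it is used: every point can be moved a
    little along [- x], and [x] is an algebraically interior point. *)
Record open_blunt_cone x C : Prop := OpenBluntCone {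
  coneD : forall u v, C u -> C v -> C (u + v);
  coneZ : forall (t : R) u, 0 < t -> C u -> C (t *: u);
  cone0 : ~ C 0;
  cone_open : forall c, C c -> exists2 eps : R, 0 < eps & C (c - eps *: x);
  cone_absorb : forall v, exists2 T : R, 0 < T & C (T *: x + v) }.

Definition add_line C w : set V := [set v | exists s : R, C (v - s *: w)].

Definition has_line C w := forall c (s : R), C c -> C (c + s *: w).

Lemma cone_apex x C : open_blunt_cone x C -> C x.
Proof.
move=> Cx; have [T T0 CT] := cone_absorb Cx 0.
have := @coneZ _ _ Cx T^-1 _ _ CT; rewrite addr0 scalerA mulVf ?gt_eqF//.
by rewrite scale1r invr_gt0; apply.
Qed.

Lemma sub_add_line C w : C `<=` add_line C w.
Proof. by move=> v Cv; exists 0; rewrite scale0r subr0. Qed.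

Lemma has_line_add C w : has_line (add_line C w) w.
Proof.
move=> c s [r Cr]; exists (r + s); rewrite scalerDl opprD addrACA.
by rewrite subrr addr0.
Qed.

Lemma has_line_add_line C e w : has_line C e -> has_line (add_line C w) e.
Proof. by move=> Ce c s [r Cr]; exists r; rewrite addrAC; exact: Ce. Qed.

(** Blunt cones survive the addition of a line that misses them: [0 = c + s w]
    would put [w] or [- w] in [C]. *)
Lemma add_line_cone x C w : open_blunt_cone x C -> ~ C w -> ~ C (- w) ->
  open_blunt_cone x (add_line C w).
Proof.
move=> Cx Cw CNw; split.
- move=> u v [r Cr] [s Cs]; exists (r + s).
  by rewrite scalerDl opprD addrACA; exact: (coneD Cx Cr Cs).
- move=> t u t0 [r Cr]; exists (t * r).
  by rewrite -scalerA -scalerBr; exact: (coneZ Cx t0 Cr).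
- case=> s; rewrite sub0r => Cs.
  have [s0|s0|s0] := ltgtP s 0.
  + apply: Cw; have s1 : 0 < (- s)^-1 by rewrite invr_gt0 oppr_gt0.
    have := coneZ Cx s1 Cs; rewrite -scaleNr scalerA mulVf ?scale1r//.
    by rewrite oppr_eq0 lt_eqF.
  + apply: CNw; have s1 : 0 < s^-1 by rewrite invr_gt0.
    by have := coneZ Cx s1 Cs; rewrite scalerN scalerA mulVf ?scale1r// gt_eqF.
  + by apply: (cone0 Cx); move: Cs; rewrite s0 scale0r oppr0.
- move=> c [s Cs]; have [eps e0 Ce] := cone_open Cx Cs.
  by exists eps => //; exists s; rewrite addrAC.
- move=> v; have [T T0 CT] := cone_absorb Cx v.
  by exists T => //; exact: sub_add_line.
Qed.

Lemma cone_scale_apex x C (t : R) : open_blunt_cone x C -> C (t *: x) -> 0 < t.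
Proof.
move=> Cx Ct; rewrite ltNge; apply/negP; rewrite le_eqVlt => /orP[/eqP t0|t0].
  by apply: (cone0 Cx); rewrite t0 scale0r in Ct.
apply: (cone0 Cx); rewrite -(subrr (t *: x)) -scaleNr.
have Nt : 0 < - t by rewrite oppr_gt0.
exact: (coneD Cx Ct (coneZ Cx Nt (cone_apex Cx))).
Qed.

(** One step of the Hahn-Banach extension: the set of [t] with [e - t x] in [C]
    is bounded above by every [t] with [t x - e] in [C], and openness keeps its
    supremum [a] out of both sets. *)
Lemma avoiding_line x C e : open_blunt_cone x C ->
  exists a : R, ~ C (e - a *: x) /\ ~ C (- (e - a *: x)).
Proof.
move=> Cx; pose S : set R := [set t | C (e - t *: x)].
have below t s : S t -> C (s *: x - e) -> t < s.
  move=> St Cs; rewrite -subr_gt0; apply: (cone_scale_apex Cx).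
  have := coneD Cx Cs (St : C _).
  by rewrite addrA subrK -scalerBl.
have S0 : S !=set0.
  have [T _ CT] := cone_absorb Cx e.
  by exists (- T); rewrite /S/= scaleNr opprK addrC.
have [T _ CT] := cone_absorb Cx (- e).
have Sub : has_sup S by split=> //; exists T => t St; rewrite ltW// (below t T).
exists (sup S); split=> [CS|].
  have [eps e0] := cone_open Cx CS.
  rewrite -addrA -opprD -scalerDl => /(ub_le_sup (proj2 Sub)).
  by rewrite gerDl leNgt e0.
rewrite opprB => CS; have [eps e0] := cone_open Cx CS.
rewrite addrAC -scalerBl => CSe.
have [t St] := sup_adherent e0 Sub.
by rewrite ltNge (ltW (below _ _ St CSe)).
Qed.

(** When [s] spans [V], every vector becomes a multiple of
    [x] modulo the lineality space of [D]; that multiple is the separating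
    linear form. *)
Lemma cone_with_lines x C (s : seq V) : open_blunt_cone x C ->
  exists D, [/\ C `<=` D, open_blunt_cone x D &
    forall e, e \in s -> exists a : R, has_line D (e - a *: x)].
Proof.
move=> Cx; elim: s => [|e s [D [CD Dx Ds]]]; first by exists C; split.
have [a [Da DNa]] := avoiding_line e Dx.
exists (add_line D (e - a *: x)); split.
- exact: subset_trans CD (@sub_add_line _ _).
- exact: add_line_cone.
- move=> e'; rewrite in_cons => /predU1P[->|/Ds[a' Da']].
    by exists a; exact: has_line_add.
  by exists a'; exact: has_line_add_line.
Qed.

End Separation.

(** The line through [b] is added to the cone before anything else: a form that
    stays positive on it has to vanish at [b]. *)
Lemma cone_separation (R : realType) m (C : set 'rV[R]_m) (x b : 'rV[R]_m) :
    open_blunt_cone x C -> ~ C b -> ~ C (- b) ->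
  exists f : 'I_m -> R, \sum_i f i * b 0 i = 0 /\
    forall c, C c -> 0 < \sum_i f i * c 0 i.
Proof.
move=> Cx Cb CNb.
have [D [CD Dx Dline]] :=
  cone_with_lines [seq delta_mx 0 i | i : 'I_m] (add_line_cone Cx Cb CNb).
have lineP (i : 'I_m) : exists a, has_line D (delta_mx 0 i - a *: x).
  by apply: Dline; apply: map_f; rewrite mem_enum.
have [f fP] := choice lineP.
pose F (v : 'rV[R]_m) := \sum_i f i * v 0 i.
have FD v : D v -> 0 < F v.
  move=> Dv; apply: (cone_scale_apex Dx).
  have -> : F v *: x = v + \sum_i (- v 0 i) *: (delta_mx 0 i - f i *: x).
    under eq_bigr do rewrite scalerBr !scaleNr opprK scalerA mulrC.
    by rewrite big_split /= sumrN -row_sum_delta addrA subrr add0r scaler_suml.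
  elim: (index_enum _) => [|i r IH]; first by rewrite big_nil addr0.
  by rewrite big_cons addrCA addrC; exact: fP.
exists f; split=> [|c Cc]; last by apply/FD/CD/sub_add_line.
change (F b = 0); apply: contrapT => /eqP Fb0.
have Fx0 : 0 < F x by exact: FD (cone_apex Dx).
(* This point of [D] is chosen on the kernel of the form. *)
have /FD : D (x + (- (F x / F b)) *: b).
  by apply: CD; apply: has_line_add; apply: sub_add_line; exact: cone_apex Cx.
have -> k : F (x + k *: b) = F x + k * F b.
  by rewrite /F mulr_sumr -big_split /=; apply: eq_bigr => i _; rewrite !mxE; ring.
by rewrite mulNr divfK// subrr ltxx.
Qed.

(** * The Lorentz form *)

Section LorentzForm.
Variables (R : realType) (n : nat).
Implicit Types (u v w nu b : 'rV[R]_n.+1) (a : R).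

Lemma lorentzC u v : lorentz u v = lorentz v u.
Proof.
by rewrite /lorentz mulrC; congr (_ + _); apply: eq_bigr => i _; rewrite mulrC.
Qed.

Lemma lorentzDr u v w : lorentz u (v + w) = lorentz u v + lorentz u w.
Proof.
rewrite /lorentz mxE mulrDr opprD addrACA -big_split; congr (_ + _).
by apply: eq_bigr => i _; rewrite mxE mulrDr.
Qed.

Lemma lorentzZr a u v : lorentz u (a *: v) = a * lorentz u v.
Proof.
rewrite /lorentz mxE mulrDr mulr_sumr mulrN mulrCA; congr (_ + _).
by apply: eq_bigr => i _; rewrite mxE mulrCA.
Qed.

Lemma lorentzNr u v : lorentz u (- v) = - lorentz u v.
Proof. by rewrite -scaleN1r lorentzZr mulN1r. Qed.

Lemma lorentzDl u v w : lorentz (u + v) w = lorentz u w + lorentz v w.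
Proof. by rewrite lorentzC lorentzDr !(lorentzC w). Qed.

Lemma lorentzZl a u v : lorentz (a *: u) v = a * lorentz u v.
Proof. by rewrite lorentzC lorentzZr lorentzC. Qed.

Lemma lorentzNl u v : lorentz (- u) v = - lorentz u v.
Proof. by rewrite lorentzC lorentzNr lorentzC. Qed.

Lemma lorentz0l v : lorentz 0 v = 0.
Proof. by rewrite -(scale0r 0) lorentzZl mul0r. Qed.

Definition lorentzE := (lorentzDl, lorentzDr, lorentzZl, lorentzZr, lorentzNl, lorentzNr).

Lemma lorentz_represents (f : 'I_n.+1 -> R) :
  exists nu, forall v, lorentz nu v = \sum_i f i * v 0 i.
Proof.
exists (\row_i (if i == ord0 then - f i else f i)) => v.
rewrite /lorentz big_ord_recl !mxE eqxx mulNr opprK; congr (_ + _).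
by apply: eq_bigr => i _; rewrite mxE.
Qed.

(** The Cauchy-Schwarz inequality: the quadratic polynomial
    [t |-> \sum_i (a i + t * b i) ^+ 2] is nonnegative at its minimum. *)
Lemma sum_mul_sqr_le m (a b : 'I_m -> R) :
  (\sum_i a i * b i) ^+ 2 <= (\sum_i a i ^+ 2) * (\sum_i b i ^+ 2).
Proof.
set A := \sum_i a i ^+ 2; set B := \sum_i b i ^+ 2; set S := \sum_i a i * b i.
have B0 : 0 <= B by apply: sumr_ge0 => i _; exact: sqr_ge0.
have Q t : 0 <= A + t * 2 * S + t ^+ 2 * B.
  rewrite /A /S /B !mulr_sumr -!big_split /=; apply: sumr_ge0 => i _.
  by rewrite (_ : _ + _ = (a i + t * b i) ^+ 2) ?sqr_ge0//; ring.
have [B_gt0|] := ltP 0 B; last first.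
  move=> B_le0; have BE : B = 0 by lra.
  have SE : S = 0.
    apply: big1 => i _.
    have /eqP : b i ^+ 2 = 0.
      by apply: (psumr_eq0P _ BE) => // j _; exact: sqr_ge0.
    by rewrite sqrf_eq0 => /eqP->; rewrite mulr0.
  by rewrite SE BE mulr0 expr0n.
have := Q (- S / B).
rewrite (_ : A + _ + _ = (A * B - S ^+ 2) / B); first last.
  by field; rewrite gt_eqF.
by rewrite pmulr_lge0 ?invr_gt0// subr_ge0.
Qed.

Let spatial u : R := \sum_(i < n) u ord0 (lift ord0 i) ^+ 2.

Let spatial_ge0 u : 0 <= spatial u.
Proof. by apply: sumr_ge0 => i _; exact: sqr_ge0. Qed.

Let lorentz_sqr u : lorentz u u = - u ord0 ord0 ^+ 2 + spatial u.
Proof. by rewrite /lorentz -expr2; under eq_bigr do rewrite -expr2. Qed.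

Let lorentz_spatial u v :
  (lorentz u v + u ord0 ord0 * v ord0 ord0) ^+ 2 <= spatial u * spatial v.
Proof. by rewrite /lorentz addrAC addNr add0r; exact: sum_mul_sqr_le. Qed.

(** The orthogonality relation bounds the time part of [nu] through
    Cauchy-Schwarz on the space parts, while [b] has more time than space. *)
Lemma timelike_orthogonal b nu : lorentz b b < 0 -> lorentz nu b = 0 ->
  nu != 0 -> 0 < lorentz nu nu.
Proof.
move=> bb nub nu0; have := lorentz_spatial nu b; rewrite nub add0r exprMn.
move: bb; rewrite !lorentz_sqr [- _ + _]addrC subr_lt0 [- _ + _]addrC subr_gt0.
have [N0|N_neq0] := eqVneq (spatial nu) 0.
  have [nu00|nu00] := eqVneq (nu ord0 ord0) 0.
    case/eqP: nu0; apply/rowP => j; rewrite mxE.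
    case: (unliftP ord0 j) => [i ->|->//]; apply/eqP; rewrite -sqrf_eq0; apply/eqP.
    by apply: (psumr_eq0P _ N0) => // k _; exact: sqr_ge0.
  move=> bb; rewrite N0 mul0r leNgt mulr_gt0 ?exprn_even_gt0//=.
  by rewrite -sqrf_eq0 gt_eqF// (le_lt_trans (spatial_ge0 b)).
move=> bb; have N_gt0 : 0 < spatial nu by rewrite lt_def N_neq0 spatial_ge0.
move=> h; rewrite -(ltr_pM2r (le_lt_trans (spatial_ge0 b) bb)).
by apply: le_lt_trans h _; rewrite ltr_pM2l.
Qed.

Lemma timelike_time_neq0 u : lorentz u u < 0 -> u ord0 ord0 != 0.
Proof.
rewrite lorentz_sqr addrC subr_lt0 => uu.
by rewrite -sqrf_eq0 gt_eqF// (le_lt_trans (spatial_ge0 u)).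
Qed.

(** By Cauchy-Schwarz, the space parts cannot compensate the product of the
    positive time coordinates. *)
Lemma lorentz_future u v : lorentz u u < 0 -> 0 < u ord0 ord0 ->
  lorentz v v < 0 -> 0 < v ord0 ord0 -> lorentz u v < 0.
Proof.
move=> + u0 + v0; have := lorentz_spatial u v.
rewrite !lorentz_sqr [- _ + _]addrC subr_lt0 [- _ + _]addrC subr_lt0.
move=> h uu vv; rewrite ltNge; apply/negP => uv.
have uv0 : 0 < u ord0 ord0 * v ord0 ord0 by rewrite mulr_gt0.
have : spatial u * spatial v < (u ord0 ord0 * v ord0 ord0) ^+ 2.
  by rewrite exprMn ltr_pM.
by apply/negP; rewrite -leNgt (le_trans _ h)// ler_sqr ?nnegrE; lra.
Qed.

End LorentzForm.

(** * Distances and geodesics in the hyperboloid *)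

Section Hyperboloid.
Variables (R : realType) (n : nat).
Implicit Types (u v w nu : 'rV[R]_n.+1) (x y z p b : hyp R n) (s t : R).

Definition mkhyp v (vH : hyp R n v) : hyp R n := exist _ v (mem_set vH).

Lemma hypP x : hyp R n (\val x).
Proof. by apply: set_mem; exact: valP. Qed.

Lemma lorentz_hyp x : lorentz (\val x) (\val x) = -1.
Proof. by case: (hypP x). Qed.

Lemma hyp_inj x y : \val x = \val y -> x = y.
Proof. exact: val_inj. Qed.


Lemma lorentz_normal x v : lorentz (\val x) (v + lorentz (\val x) v *: \val x) = 0.
Proof. by rewrite !lorentzE lorentz_hyp; lra. Qed.

Lemma lorentz_hyp_lt0 x y : lorentz (\val x) (\val y) < 0.
Proof.
have [xx x0] := hypP x; have [yy y0] := hypP y.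
by apply: lorentz_future; rewrite ?xx ?yy ?ltrN10.
Qed.

(** The reverse Cauchy-Schwarz inequality, obtained from the spacelike
    character of the component of [y] orthogonal to [x]. *)
Lemma lorentz_hyp_lt x y : x <> y -> lorentz (\val x) (\val y) < -1.
Proof.
move=> xy; have xy0 := lorentz_hyp_lt0 x y.
set k := lorentz _ _ in xy0 *; pose w := \val y + k *: \val x.
have wx : lorentz w (\val x) = 0 by rewrite lorentzC lorentz_normal.
have ww : lorentz w w = k ^+ 2 - 1.
  by rewrite /w !lorentzE !lorentz_hyp (lorentzC (\val y)) -/k; ring.
have w0 : w != 0.
  apply/eqP => w0; apply: xy; apply: hyp_inj; apply/eqP.
  have k2 : k ^+ 2 - 1 = 0 by rewrite -ww w0 lorentz0l.
  have k1 : k = -1 by nra.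
  by rewrite eq_sym -subr_eq0 -w0 /w k1 scaleN1r.
have xx : lorentz (\val x) (\val x) < 0 by rewrite lorentz_hyp ltrN10.
have := timelike_orthogonal xx wx w0; rewrite ww; nra.
Qed.

Lemma lorentz_hyp_le x y : lorentz (\val x) (\val y) <= -1.
Proof.
have [->|/eqP/lorentz_hyp_lt/ltW//] := eqVneq x y.
by rewrite lorentz_hyp.
Qed.

(** Distinguishes the two sheets of [<v, v> = -1]: otherwise [- v] would be on
    the upper sheet, and two points of that sheet have a negative product. *)
Lemma hyp_future x v : lorentz v v = -1 -> lorentz (\val x) v < 0 -> hyp R n v.
Proof.
move=> vv xv; split=> //; have vv0 : lorentz v v < 0 by rewrite vv ltrN10.
rewrite lt_neqAle eq_sym timelike_time_neq0//= leNgt; apply/negP => v0.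
have [xx x0] := hypP x.
have : lorentz (\val x) (- v) < 0.
  apply: lorentz_future => //; rewrite ?xx ?ltrN10//.
    by rewrite !lorentzE opprK vv ltrN10.
  by rewrite mxE oppr_gt0.
by rewrite lorentzE; lra.
Qed.

Lemma cosh_hdist x y : cosh (hdist x y) = - lorentz (\val x) (\val y).
Proof. by rewrite cosh_arcosh// lerNr lorentz_hyp_le. Qed.

Lemma hdist_gt0 x y : x <> y -> 0 < hdist x y.
Proof.
move=> /lorentz_hyp_lt xy.
have d_ge0 : 0 <= hdist x y by apply: arcosh_ge0; lra.
rewrite lt_def d_ge0 andbT; apply/eqP => d0.
by have := cosh_hdist x y; rewrite d0 cosh0; lra.
Qed.

(** The nearest point of the hyperplane is the normalized orthogonal projection
    [w] of [x]: as [<x, q> = c * <w, q>] on [nu^perp], the reverse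
    Cauchy-Schwarz inequality makes [arcosh c] the minimal distance, and
    [c ^+ 2 = 1 + <nu, x> ^+ 2]. *)
Lemma sinh_hdist_plane nu x : lorentz nu nu = 1 ->
  sinh (hdist_set x (hplane nu)) = `|lorentz nu (\val x)|.
Proof.
move=> nu1; set s := lorentz nu (\val x).
pose c := Num.sqrt (1 + s ^+ 2).
have c2 : c ^+ 2 = 1 + s ^+ 2 by rewrite sqr_sqrtr// addr_ge0// sqr_ge0.
have c0 : 0 < c by rewrite sqrtr_gt0 ltr_wpDr// sqr_ge0.
have c1 : 1 <= c by have := sqr_ge0 s; nra.
pose w := c^-1 *: (\val x - s *: nu).
have ww : lorentz w w = -1.
  rewrite /w !lorentzE (lorentzC (\val x)) lorentz_hyp nu1 -/s.
  transitivity (- ((1 + s ^+ 2) / c ^+ 2)); first by field; rewrite gt_eqF.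
  by rewrite -c2 divff// expf_neq0// gt_eqF.
have xw : lorentz (\val x) w = - c.
  rewrite /w !lorentzE (lorentzC (\val x)) lorentz_hyp -/s.
  transitivity (- ((1 + s ^+ 2) / c)); first by ring.
  by rewrite -c2 expr2 mulfK// gt_eqF.
have wH : hyp R n w by apply: (@hyp_future x) => //; rewrite xw; lra.
pose p := mkhyp wH.
have nup : hplane nu p.
  by rewrite /hplane/= /w !lorentzE nu1 -/s; ring.
have lb q : hplane nu q -> arcosh c <= hdist x q.
  rewrite /hplane/= => nuq; apply: arcosh_le => //; rewrite lerNr.
  have := lorentz_hyp_le p q; rewrite /= /w !lorentzE nuq mulr0 subr0.
  by rewrite mulrC ler_pdivrMr// mulN1r.
have -> : hdist_set x (hplane nu) = arcosh c.
  apply/eqP; rewrite eq_le; apply/andP; split.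
    rewrite (_ : arcosh c = hdist x p).
      by apply: ge_inf; [exists (arcosh c) => _ [q /lb ? <-]|exists p].
    by rewrite /hdist /= xw opprK.
  by apply: lb_le_inf; [exists (hdist x p), p|move=> _ [q /lb ? <-]].
by rewrite sinh_arcosh// c2 addrAC subrr add0r sqrtr_sqr.
Qed.

Section Geodesic.
Variables (x y : hyp R n).
Hypothesis xy : x <> y.
Let xi := hdir x y.
Let d := hdist x y.

Let sinh_d_gt0 : 0 < sinh d. Proof. by rewrite sinh_gt0 hdist_gt0. Qed.

Lemma lorentz_hdir : lorentz (\val x) xi = 0.
Proof.
by rewrite /xi /hdir cosh_hdist !lorentzE lorentz_hyp -/d; ring.
Qed.

Lemma lorentz_hdir_sqr : lorentz xi xi = 1.
Proof.
rewrite /xi /hdir -/d !lorentzE !lorentz_hyp (lorentzC (\val y)).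
rewrite -[lorentz (\val x) _]opprK -cosh_hdist -/d.
rewrite (_ : _ * _ = (cosh d ^+ 2 - 1) / sinh d ^+ 2); last first.
  by field; rewrite gt_eqF.
by rewrite cosh_sinh_sqr addrAC subrr add0r divff// expf_neq0// gt_eqF.
Qed.

Lemma hexp_hdist : hexp x xi d = \val y.
Proof.
rewrite /hexp /xi /hdir -/d scalerA mulfV ?gt_eqF// scale1r.
by rewrite addrC subrK.
Qed.

Lemma hexp0 : hexp x xi 0 = \val x.
Proof. by rewrite /hexp cosh0 sinh0 scale1r scale0r addr0. Qed.

Lemma lorentz_hexp s t : lorentz (hexp x xi s) (hexp x xi t) = - cosh (s - t).
Proof.
rewrite /hexp; move: lorentz_hdir lorentz_hdir_sqr; move: xi => w xw ww.
by rewrite !lorentzE (lorentzC w) xw ww lorentz_hyp coshB; ring.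
Qed.

Lemma hexp_hyp t : hyp R n (hexp x xi t).
Proof.
apply: (@hyp_future x); first by rewrite lorentz_hexp subrr cosh0.
by rewrite -hexp0 lorentz_hexp oppr_lt0 cosh_gt0.
Qed.

Definition geod t : hyp R n := mkhyp (hexp_hyp t).

Lemma geod0 : geod 0 = x.
Proof. by apply: hyp_inj; rewrite /= hexp0. Qed.

Lemma geod_hdist : geod d = y.
Proof. by apply: hyp_inj; rewrite /= hexp_hdist. Qed.

Lemma hdist_geod s t : s <= t -> hdist (geod s) (geod t) = t - s.
Proof.
move=> st; rewrite /hdist /= lorentzC lorentz_hexp opprK coshK//.
by rewrite subr_ge0.
Qed.

Lemma hray_geod z : hray x y z <-> exists2 t : R, 0 < t & z = geod t.
Proof.
split=> -[t t0 zt]; exists t => //; last by rewrite zt.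
by apply: hyp_inj; rewrite zt.
Qed.

(** Each coordinate of a geodesic is a solution of [f'' = f], so three values
    are linearly dependent; the coefficients come from the addition formula. *)
Lemma geod_interp r s t : sinh (t - r) *: \val (geod s) =
  sinh (t - s) *: \val (geod r) + sinh (s - r) *: \val (geod t).
Proof.
rewrite /= /hexp; move: xi => w; rewrite !scalerDr !scalerA addrACA -!scalerDl.
by congr (_ *: _ + _ *: _); rewrite /cosh /sinh !opprB !expRD; field.
Qed.

Lemma lorentz_geod nu r s t : sinh (t - r) * lorentz nu (\val (geod s)) =
  sinh (t - s) * lorentz nu (\val (geod r)) + sinh (s - r) * lorentz nu (\val (geod t)).
Proof. by rewrite -lorentzZr geod_interp lorentzDr !lorentzZr. Qed.

Lemma hexp_continuous : continuous (hexp x xi).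
Proof.
move=> t; apply: cvgD.
  by apply: cvgZ; [exact: cosh_continuous|exact: cvg_cst].
by apply: cvgZ; [exact: sinh_continuous|exact: cvg_cst].
Qed.

Lemma geod_continuous : continuous geod.
Proof.
apply: continuous_comp_initial; exact: hexp_continuous.
Qed.

Lemma geod_near (U : set (hyp R n)) s : nbhs (geod s) U ->
  exists2 e, 0 < e & forall t, `|t - s| < e -> U (geod t).
Proof.
move=> /geod_continuous/nbhs_ballP[e /= e0 eU]; exists e => // t ts.
by apply: eU; rewrite /ball/= distrC.
Qed.

End Geodesic.

Lemma normalize x v : lorentz v v < 0 -> lorentz (\val x) v < 0 ->
  exists2 k : R, 0 < k & exists z, v = k *: \val z.
Proof.
move=> vv xv; pose k := Num.sqrt (- lorentz v v).
have k0 : 0 < k by rewrite sqrtr_gt0 oppr_gt0.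
have k2 : k ^+ 2 = - lorentz v v by rewrite sqr_sqrtr// oppr_ge0 ltW.
have vH : hyp R n (k^-1 *: v).
  apply: (@hyp_future x); rewrite !lorentzE.
    rewrite -[lorentz v v]opprK -k2; field; rewrite gt_eqF//.
  by rewrite pmulr_rlt0// invr_gt0.
exists k => //; exists (mkhyp vH).
by rewrite /= scalerA mulfV ?gt_eqF// scale1r.
Qed.

Lemma lorentz_continuous nu : continuous (lorentz nu).
Proof.
move=> v; have FF : Filter (nbhs v) by exact: (@nbhs_filter 'rV[R]_n.+1).
have nuv i :
    (fun w : 'rV[R]_n.+1 => nu ord0 i * w ord0 i) @ v --> nu ord0 i * v ord0 i.
  apply: cvgM; [exact: cvg_cst|exact: coord_continuous].
apply: cvgD; first exact: cvgN (nuv ord0).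
by apply: cvg_big => [|i _]; [exact: add_continuous|exact: nuv].
Qed.

Lemma val_hyp_continuous : continuous (fun z : hyp R n => \val z).
Proof. exact: initial_continuous. Qed.

(** The parameter of [z] is read off from [cosh d(x, z) = - <x, z>]; that it
    does not exceed [d(x, y)] amounts to [sinh (d - t) = al * sinh d]. *)
Lemma hsegment_combination x y z (al be : R) : x <> y ->
  0 <= al -> 0 <= be -> \val z = al *: \val x + be *: \val y ->
  hsegment x y z.
Proof.
move=> xy al0 be0 zE; pose d := hdist x y.
have d0 : 0 < d by exact: hdist_gt0.
have sd0 : 0 < sinh d by rewrite sinh_gt0.
have cd := cosh_sinh_sqr d; have c1 : 1 <= cosh d.
  by rewrite cosh_hdist lerNr lorentz_hyp_le.
have := lorentz_hyp z; rewrite zE !lorentzE !lorentz_hyp (lorentzC (\val y)).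
rewrite -[lorentz _ _]opprK -cosh_hdist -/d => zz.
pose c := al + be * cosh d.
have cE : c ^+ 2 - 1 = (be * sinh d) ^+ 2.
  rewrite exprMn (_ : sinh d ^+ 2 = cosh d ^+ 2 - 1); last by rewrite cd; ring.
  by rewrite /c; lra.
have c_ge0 : 0 <= c by rewrite /c; nra.
have c_ge1 : 1 <= c by have := sqr_ge0 (be * sinh d); nra.
pose t := arcosh c.
have ct : cosh t = c by rewrite cosh_arcosh.
have st : sinh t = be * sinh d.
  by rewrite sinh_arcosh// cE sqrtr_sqr ger0_norm// mulr_ge0// ltW.
exists t; last first.
  rewrite zE /hexp /hdir -/d ct st scalerA mulfK ?gt_eqF// scalerBr scalerA.
  by rewrite /c scalerDl -addrA; congr (_ + _); rewrite addrC subrK.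
rewrite arcosh_ge0//= -subr_ge0 -sinh_ge0 -/d -/t sinhB ct st /c.
have -> : sinh d * (al + be * cosh d) - cosh d * (be * sinh d) = sinh d * al.
  by move: (sinh d) (cosh d) => a b; ring.
by rewrite mulr_ge0// ltW.
Qed.

End Hyperboloid.

(** * The cone over a convex domain and its supporting hyperplanes *)

Section ConvexDomain.
Variables (R : realType) (n : nat) (Omega : set (hyp R n)).
Hypotheses (Omega_open : open Omega) (Omega_convex : hconvex Omega).
Implicit Types (x y z p b : hyp R n) (nu v : 'rV[R]_n.+1).

Definition cone_over : set 'rV[R]_n.+1 :=
  [set c | exists2 k : R, 0 < k & exists2 z, Omega z & c = k *: \val z].

Lemma cone_over_scale (k : R) c : 0 < k -> cone_over c -> cone_over (k *: c).
Proof.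
move=> k0 [l l0 [z Oz ->]]; exists (k * l); first exact: mulr_gt0.
by exists z => //; rewrite scalerA.
Qed.

Lemma cone_over_hyp z : cone_over (\val z) -> Omega z.
Proof.
case=> k k0 [p Op zp]; have := lorentz_hyp z.
rewrite zp !lorentzE lorentz_hyp => kk; have k1 : k = 1 by nra.
by move: zp; rewrite k1 scale1r => /hyp_inj->.
Qed.

Lemma mem_cone_over z : Omega z -> cone_over (\val z).
Proof. by exists 1 => //; exists z; rewrite ?scale1r. Qed.

Lemma cone_over_add u v : cone_over u -> cone_over v -> cone_over (u + v).
Proof.
case=> k k0 [x Ox ->] [l l0 [y Oy ->]].
have [<-|/eqP xy] := eqVneq x y.
  exists (k + l); first exact: addr_gt0.
  by exists x => //; rewrite scalerDl.
have xy0 := lorentz_hyp_lt0 x y.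
have kl : 0 < k * l by exact: mulr_gt0.
have [||N N0 [z zE]] := @normalize _ _ x (k *: \val x + l *: \val y).
- by rewrite !lorentzE !lorentz_hyp (lorentzC (\val y)); nra.
- by rewrite !lorentzE !lorentz_hyp; nra.
exists N => //; exists z => //.
apply: (Omega_convex Ox Oy xy).
apply: (@hsegment_combination _ _ _ _ _ (k / N) (l / N)) => //.
- by rewrite ltW// divr_gt0.
- by rewrite ltW// divr_gt0.
rewrite ![_ / N]mulrC -!scalerA -scalerDr zE scalerA mulVf ?gt_eqF//.
by rewrite scale1r.
Qed.

Lemma cone_over_blunt : ~ cone_over 0.
Proof.
case=> k k0 [z _ z0]; have := lorentz_hyp z.
have -> : \val z = 0.
  by apply: (scalerI (lt0r_neq0 k0)); rewrite -z0 scaler0.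
by rewrite lorentz0l; lra.
Qed.

(** Prolonging the geodesic from [x] to [z] slightly beyond [z] stays in
    [Omega], and by [geod_interp] the new point is a positive multiple of some
    [z - e x]. *)
Lemma cone_over_open x c : Omega x -> cone_over c ->
  exists2 eps : R, 0 < eps & cone_over (c - eps *: \val x).
Proof.
move=> Ox [k k0 [z Oz ->]].
suff [e e0 ze] : exists2 e : R, 0 < e & cone_over (\val z - e *: \val x).
  exists (k * e); first exact: mulr_gt0.
  by rewrite -scalerA -scalerBr; exact: cone_over_scale.
have [<-|/eqP xz] := eqVneq x z.
  exists (2^-1); first by rewrite invr_gt0.
  rewrite -{1}[\val x]scale1r -scalerBl; apply: cone_over_scale; first by lra.
  exact: mem_cone_over.
pose d := hdist x z; have d0 : 0 < d by exact: hdist_gt0.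
have [e e0 Oe] : exists2 e : R, 0 < e & forall t, `|t - d| < e -> Omega (geod xz t).
  by apply: geod_near; rewrite geod_hdist; exact: open_nbhs_nbhs.
pose t := d + e / 2; have t0 : 0 < sinh t by rewrite sinh_gt0 /t; lra.
have et : 0 < sinh (t - d) by rewrite sinh_gt0 /t; lra.
have Ot : Omega (geod xz t).
  by apply: Oe; rewrite /t addrAC subrr add0r gtr0_norm; lra.
exists (sinh (t - d) / sinh t); first exact: divr_gt0.
have -> : \val z - (sinh (t - d) / sinh t) *: \val x
    = (sinh d / sinh t) *: \val (geod xz t).
  apply: (scalerI (lt0r_neq0 t0)).
  rewrite scalerBr !scalerA ![sinh t * (_ / _)]mulrC !divfK ?gt_eqF//.
  apply/eqP; rewrite subr_eq; apply/eqP.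
  have := geod_interp xz 0 d t; rewrite !subr0 geod0 geod_hdist => ->.
  by rewrite addrC.
apply: cone_over_scale; last exact: mem_cone_over.
by rewrite divr_gt0// sinh_gt0.
Qed.

(** For large [T], the vector [T x + v] is future timelike, hence points to some
    [w] of the hyperbolic space.  The beginning of the geodesic from [x] to [w]
    lies in [Omega] and consists of multiples of vectors [T' x + v]. *)
Lemma cone_over_absorb x v : Omega x ->
  exists2 T : R, 0 < T & cone_over (T *: \val x + v).
Proof.
move=> Ox; pose T := 1 + 2 * `|lorentz (\val x) v| + `|lorentz v v|.
have a0 := normr_ge0 (lorentz (\val x) v); have b0 := normr_ge0 (lorentz v v).
have a1 := ler_norm (lorentz (\val x) v); have b1 := ler_norm (lorentz v v).
have T0 : 0 < T by rewrite /T; lra.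
have [||N N0 [w wE]] := @normalize _ _ x (T *: \val x + v).
- rewrite !lorentzE !lorentz_hyp (lorentzC v).
  have T1 : 1 <= T by rewrite /T; lra.
  have TE : T * T = T + 2 * (T * `|lorentz (\val x) v|) + T * `|lorentz v v|.
    by rewrite {2}/T; ring.
  have Ta : T * lorentz (\val x) v <= T * `|lorentz (\val x) v| by rewrite ler_pM2l.
  have Tb : `|lorentz v v| <= T * `|lorentz v v| by rewrite ler_peMl.
  by lra.
- by rewrite !lorentzE !lorentz_hyp /T; lra.
have [xw|/eqP xw] := eqVneq x w.
  by exists T => //; rewrite wE -xw; apply: cone_over_scale => //; exact: mem_cone_over.
pose d := hdist x w; have d0 : 0 < d by exact: hdist_gt0.
have [e e0 Oe] : exists2 e : R, 0 < e & forall t, `|t - 0| < e -> Omega (geod xw t).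
  by apply: geod_near; rewrite geod0; exact: open_nbhs_nbhs.
pose t := Num.min d e / 2; have m0 : 0 < Num.min d e by rewrite lt_min d0.
have md : Num.min d e <= d by rewrite ge_min lexx.
have me : Num.min d e <= e by rewrite ge_min lexx orbT.
have t0 : 0 < sinh t by rewrite sinh_gt0 /t; lra.
have dt : 0 < sinh (d - t) by rewrite sinh_gt0 /t; lra.
have sd : 0 < sinh d by rewrite sinh_gt0.
have Ot : Omega (geod xw t).
  by apply: Oe; rewrite subr0 gtr0_norm /t; lra.
exists (T + N * sinh (d - t) / sinh t).
  by rewrite addr_gt0// divr_gt0// mulr_gt0.
have -> : (T + N * sinh (d - t) / sinh t) *: \val x + v
    = (N * sinh d / sinh t) *: \val (geod xw t).
  have interp : sinh d *: \val (geod xw t) = sinh (d - t) *: \val x + sinh t *: \val w.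
    by have := geod_interp xw 0 t d; rewrite !subr0 geod0 geod_hdist.
  rewrite ![N * _ / _]mulrAC -[RHS]scalerA interp scalerDr.
  by rewrite !scalerA divfK ?gt_eqF// scalerDl addrAC wE addrC.
apply: cone_over_scale; last exact: mem_cone_over.
by rewrite divr_gt0// mulr_gt0.
Qed.

Lemma cone_over_open_blunt x : Omega x -> open_blunt_cone (\val x) cone_over.
Proof.
move=> Ox; split.
- exact: cone_over_add.
- by move=> k c; exact: cone_over_scale.
- exact: cone_over_blunt.
- by move=> c; exact: cone_over_open.
- by move=> v; exact: cone_over_absorb.
Qed.

Lemma support_through x b : Omega x -> ~ Omega b ->
  exists nu, [/\ lorentz nu nu = 1, hplane nu b & Omega `<=` hhalfspace nu].
Proof.
move=> Ox Ob.
have Cb : ~ cone_over (\val b) by move=> /cone_over_hyp.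
have CNb : ~ cone_over (- \val b).
  move=> [k k0 [z _ bz]]; have := lorentz_hyp_lt0 b z.
  have := lorentz_hyp b; rewrite -{2}[\val b]opprK bz !lorentzE => bb.
  by rewrite ltNge => /negP; apply; nra.
have [f [fb fC]] := cone_separation (cone_over_open_blunt Ox) Cb CNb.
have [mu muf] := lorentz_represents f.
have mub : lorentz mu (\val b) = 0 by rewrite muf.
have muO z : Omega z -> 0 < lorentz mu (\val z).
  by rewrite muf => Oz; apply: fC; exact: mem_cone_over.
have mu0 : mu != 0.
  by apply: contraTneq (muO _ Ox) => ->; rewrite lorentz0l ltxx.
have bb : lorentz (\val b) (\val b) < 0 by rewrite lorentz_hyp ltrN10.
have mumu := timelike_orthogonal bb mub mu0.
pose m := Num.sqrt (lorentz mu mu); have m0 : 0 < m by rewrite sqrtr_gt0.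
have m2 : m ^+ 2 = lorentz mu mu by rewrite sqr_sqrtr// ltW.
exists (m^-1 *: mu); split.
- by rewrite !lorentzE -m2; field; rewrite gt_eqF.
- by rewrite /hplane/= lorentzE mub mulr0.
- by move=> z Oz; rewrite /hhalfspace/= lorentzE mulr_gt0 ?invr_gt0//; exact: muO.
Qed.

Lemma bdry_notin b : bdry Omega b -> ~ Omega b.
Proof. by move=> [_ nb] Ob; apply/nb/open_nbhs_nbhs. Qed.

Lemma bdry_halfspace nu b : Omega `<=` hhalfspace nu -> bdry Omega b ->
  0 <= lorentz nu (\val b).
Proof.
move=> Onu [clb _]; rewrite leNgt; apply/negP => nub.
have : nbhs b [set z : hyp R n | lorentz nu (\val z) < 0].
  apply: (@val_hyp_continuous _ _ b [set v | lorentz nu v < 0]).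
  exact: (cvgr_lt _ (@lorentz_continuous _ _ nu (\val b))).
move=> /clb[z [/Onu/= zpos zneg]].
by rewrite /hhalfspace/= in zpos; have := lt_trans zpos zneg; rewrite ltxx.
Qed.

(** The exit parameter is the infimum of those at which the ray is outside of
    [Omega]. *)
Lemma ray_exit x y : Omega x -> x <> y -> ~ (hray x y `<=` Omega) ->
  (hray x y `&` bdry Omega) !=set0.
Proof.
move=> Ox xy ray; pose S : set R := [set t | 0 < t /\ ~ Omega (geod xy t)].
have [t1 [t1_gt0 Ot1]] : S !=set0.
  apply: contrapT => S0; apply: ray => z /(hray_geod xy)[t t0 ->].
  by apply: contrapT => Ot; apply: S0; exists t.
have lbS : lbound S 0 by move=> t [/ltW].
have infS : has_inf S by split; [exists t1|exists 0].
pose T := inf S.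
have T_ge0 : 0 <= T by apply: lb_le_inf lbS; exists t1.
have OT : ~ Omega (geod xy T).
  move=> OT; have [e e0 Oe] := geod_near (open_nbhs_nbhs (conj Omega_open OT)).
  have [t St tT] := inf_adherent e0 infS; case: (St) => _; apply; apply: Oe.
  have Tt : T <= t by apply: ge_inf => //; exists 0.
  by rewrite ger0_norm ?subr_ge0// ltrBlDl.
have T0 : 0 < T.
  rewrite lt_def T_ge0 andbT; apply/eqP => T0.
  by apply: OT; rewrite T0 geod0.
exists (geod xy T); split; first by apply/(hray_geod xy); exists T.
split; last by move=> /interior_subset.
move=> B /geod_near[e e0 Be].
pose m := Num.min T e; have m0 : 0 < m by rewrite lt_min T0.
have mT : m <= T by rewrite ge_min lexx.
have me : m <= e by rewrite ge_min lexx orbT.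
exists (geod xy (T - m / 2)); split; last first.
  by apply: Be; rewrite addrAC subrr add0r normrN gtr0_norm; lra.
apply: contrapT => Om; have : T <= T - m / 2; last by lra.
by apply: ge_inf; [exists 0|split=> //; lra].
Qed.

End ConvexDomain.

(** * The Funk metric *)

(** Replacing [nu] by [- nu] puts [Omega] on the positive side. *)
Lemma support_halfspace (R : realType) (n : nat) (Omega : set (hyp R n)) pi :
    supporting_hyperplanes Omega pi ->
  exists nu, [/\ lorentz nu nu = 1, pi = hplane nu & Omega `<=` hhalfspace nu].
Proof.
case=> nu [nu1 -> _ []]; first by exists nu.
exists (- nu); split=> //; first by rewrite !lorentzE opprK.
by apply/seteqP; split=> z; rewrite /hplane/= lorentzNl => h;
  [rewrite h oppr0|rewrite -[LHS]opprK h oppr0].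
Qed.

Theorem theorem3p2 (R : realType) (n : nat) (Omega : set (hyp R n))
    (Omega_neq0 : Omega !=set0) (Omega_open : open Omega)
    (Omega_convex : hconvex Omega) (x y : hyp R n)
    (Omega_x : Omega x) (Omega_y : Omega y) (x_neq_y : x <> y)
    (ray_exits : ~ (hray x y `<=` Omega)) :
  (funk Omega x y)%:E =
  ereal_sup [set (ln (sinh (hdist_set x pi) / sinh (hdist_set y pi)))%:E
            | pi in supporting_hyperplanes Omega].
Proof.
have exits := ray_exit Omega_open Omega_x x_neq_y ray_exits.
have [] := xgetPex x exits; rewrite -/(exit_point Omega x y).
rewrite /funk asboolT//; move: (exit_point _ _ _) => b xyb bO.
have [nu [nu1 nub Onu]] := support_through Omega_open Omega_convex Omega_x
  (bdry_notin Omega_open bO).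
pose d := hdist x y; have d0 : 0 < d by exact: hdist_gt0.
have [t t0 bE] := (hray_geod x_neq_y b).1 xyb.
have along mu : sinh t * lorentz mu (\val y) =
    sinh (t - d) * lorentz mu (\val x) + sinh d * lorentz mu (\val b).
  by have := lorentz_geod x_neq_y mu 0 d t; rewrite !subr0 geod0 geod_hdist bE.
have st0 : 0 < sinh t by rewrite sinh_gt0.
have sd0 : 0 < sinh d by rewrite sinh_gt0.
have nux : 0 < lorentz nu (\val x) by exact: Onu.
have nuy : 0 < lorentz nu (\val y) by exact: Onu.
have nuE : sinh t * lorentz nu (\val y) = sinh (t - d) * lorentz nu (\val x).
  by rewrite along nub mulr0 addr0.
have std0 : 0 < sinh (t - d) by rewrite -(pmulr_lgt0 _ nux) -nuE mulr_gt0.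
have td : d <= t by rewrite -subr_ge0 ltW// -sinh_gt0.
have -> : hdist x b = t.
  by rewrite bE -{1}(geod0 x_neq_y) hdist_geod ?subr0// ltW.
have -> : hdist y b = t - d.
  by rewrite bE -{1}(geod_hdist x_neq_y) hdist_geod.
apply/eqP; rewrite eq_le; apply/andP; split.
  apply: ereal_sup_ubound; exists (hplane nu).
    by exists nu; split=> //; [exists b|left].
  rewrite !sinh_hdist_plane// !gtr0_norm//; congr (ln _)%:E.
  by apply/eqP; rewrite eqr_div ?lt0r_neq0// nuE mulrC.
apply/ereal_supP => _ [_ /support_halfspace[mu [mu1 -> Omu]] <-].
have mux : 0 < lorentz mu (\val x) by exact: Omu.
have muy : 0 < lorentz mu (\val y) by exact: Omu.
have quot_mu := divr_gt0 mux muy; have quot_t := divr_gt0 st0 std0.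
rewrite !sinh_hdist_plane// !gtr0_norm// lee_fin ler_ln ?posrE//.
rewrite ler_pdivrMr// mulrAC ler_pdivlMr// mulrC along lerDl.
apply: mulr_ge0; [exact: ltW|exact: (bdry_halfspace Omu bO)].
Qed.
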